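(* Let $N=2^n$, let $\{|\lambda_j\rangle\}_{j=0}^{N-1}$ be an orthonormal basis and $\mathcal{Q}$ a unitary with $U_{\omega_\lambda}=\mathcal{Q}^\dagger U_\omega\mathcal{Q}$, such that implementing $\mathcal{Q}$ requires $\mathcal{O}(\chi)$ 1- and 2-qubit gates. Let $\mathcal{A}=P(U_{\omega_\lambda})=\sum_{k=0}^{d}\alpha_kU_{\omega_\lambda}^k$ with $\deg P=d$ and $|P(x)|^2\le c$ for all $x\in\mathbb{T}$. Then $\mathcal{A}/\sqrt{c}$ can be implemented (as the top-left block, with respect to one ancilla qubit, of a unitary circuit) using $\mathcal{O}(d\log N+\chi)$ 1- and 2-qubit gates.
   Context: $\mathbb{T}=\{x\in\mathbb{C}:|x|=1\}$, $\omega_N=e^{2\pi i/N}$, $U_\omega=\sum_{j=0}^{N-1}\omega_N^j|j\rangle\langle j|$ in the computational basis, and $U_{\omega_\lambda}=\sum_{j=0}^{N-1}\omega_N^j|\lambda_j\rangle\langle\lambda_j|$. Gates are arbitrary 1- and 2-qubit unitaries. *)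

(* Defs.v *)
(* complex numbers C := R[i] over an arbitrary realType R. *)
From HB Require Import structures.
From mathcomp Require Import all_boot all_order all_algebra.
From mathcomp Require Import complex.
From mathcomp Require Import all_classical all_reals.
From mathcomp Require Import trigo.
Set Implicit Arguments. Unset Strict Implicit. Unset Printing Implicit Defensive.
Import Order.TTheory GRing.Theory Num.Theory.
Local Open Scope ring_scope.
Local Open Scope complex_scope.

Section QDefs.
Variable R : realType.
Local Notation C := R[i].

(* conjugate transpose *)
Definition adj {m k : nat} (A : 'M[C]_(m, k)) : 'M[C]_(k, m) :=
  (map_mx (fun z : C => z^*) A)^T.

Definition unitary {m : nat} (A : 'M[C]_m) : Prop := A *m adj A = 1%:M.

(* omega_N = e^{2 pi i / N} *)
Definition omegaN (N : nat) : C :=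
  (cos (2 * pi / N%:R)) +i* (sin (2 * pi / N%:R)).

(* bit k of the index i (qubit k <-> bit k of the computational-basis label) *)
Definition bit (k i : nat) : nat := odd (i %/ 2 ^ k).

(* i and j agree on all bits outside the set ks *)
Definition agree_off (n : nat) (ks : seq nat) (i j : nat) : bool :=
  [forall b : 'I_n, (nat_of_ord b \notin ks) ==> (bit b i == bit b j)].

(* 1-qubit gate G acting on qubit k of an n-qubit register *)
Definition gate1 (n : nat) (k : nat) (G : 'M[C]_2) : 'M[C]_(2 ^ n) :=
  \matrix_(i, j) (if agree_off n [:: k] i j
                  then G (inord (bit k i)) (inord (bit k j)) else 0).

(* 2-qubit gate G acting on the ordered pair of qubits (k1, k2) *)
Definition gate2 (n : nat) (k1 k2 : nat) (G : 'M[C]_4) : 'M[C]_(2 ^ n) :=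
  \matrix_(i, j) (if agree_off n [:: k1; k2] i j
                  then G (inord (2 * bit k1 i + bit k2 i))
                         (inord (2 * bit k1 j + bit k2 j)) else 0).

(* elementary gates: arbitrary 1- and 2-qubit unitaries *)
Definition elem_gate (n : nat) (M : 'M[C]_(2 ^ n)) : Prop :=
  (exists (k : 'I_n) (G : 'M[C]_2), unitary G /\ M = gate1 n k G) \/
  (exists (k1 k2 : 'I_n) (G : 'M[C]_4),
      k1 != k2 /\ unitary G /\ M = gate2 n k1 k2 G).

(* U is exactly implemented by a circuit of at most m elementary gates *)
Definition circuit_size_le (n : nat) (U : 'M[C]_(2 ^ n)) (m : nat) : Prop :=
  exists gs : seq 'M[C]_(2 ^ n),
    [/\ (size gs <= m)%N, (forall g, g \in gs -> elem_gate g)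
       & U = foldr mulmx 1%:M gs].

(* U_omega = sum_j omega_N^j |j><j| on n qubits, N = 2^n *)
Definition Uomega (n : nat) : 'M[C]_(2 ^ n) :=
  \sum_(j < 2 ^ n) (omegaN (2 ^ n) ^+ j) *: delta_mx j j.

(* orthonormal basis {|lambda_j>}: the columns of lam *)
Definition orthonormal_basis (n : nat) (lam : 'M[C]_(2 ^ n)) : Prop :=
  adj lam *m lam = 1%:M.

(* U_{omega_lambda} = sum_j omega_N^j |lambda_j><lambda_j| *)
Definition Uomega_lam (n : nat) (lam : 'M[C]_(2 ^ n)) : 'M[C]_(2 ^ n) :=
  \sum_(j < 2 ^ n) (omegaN (2 ^ n) ^+ j) *: (col j lam *m adj (col j lam)).

(* P(U) = sum_k alpha_k U^k, alpha_k the coefficients of P *)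
Definition poly_mx (n : nat) (p : {poly C}) (U : 'M[C]_(2 ^ n)) : 'M[C]_(2 ^ n) :=
  \sum_(k < size p) p`_k *: U ^+ k.

Lemma leq_pow2S (n : nat) : (2 ^ n <= 2 ^ n.+1)%N.
Proof. by rewrite expnS leq_pmull // expn_gt0. Qed.

(* top-left block of an (n+1)-qubit matrix with respect to the ancilla,
   which is the most significant qubit (qubit n), i.e. the block where the
   ancilla is |0> in both input and output *)
Definition top_left (n : nat) (U : 'M[C]_(2 ^ n.+1)) : 'M[C]_(2 ^ n) :=
  \matrix_(i, j) U (widen_ord (leq_pow2S n) i) (widen_ord (leq_pow2S n) j).

End QDefs.

(* Main.v *)
(** Over the computational basis, U_omega is diagonal with eigenvalues on the
    unit circle, and conjugating by Q costs two copies of its circuit, so it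
    suffices to encode P(U_omega).  Normalise so that |P| <= 1 on the circle;
    the Fejer-Riesz theorem gives a polynomial S of degree at most d with
    |P|^2 + |S|^2 = 1 there.  Comparing extreme coefficients, (P_0, S_0) is
    orthogonal to (P_d, S_d), hence a rotation of the ancilla turns (P, S) into
    (x P', S') with P', S' of degree less than d.  Iterating, (P, S) is produced
    by d + 1 ancilla rotations interleaved with d copies of U_omega controlled
    by the ancilla, each of which is a product of n controlled phases because
    omega^j factors over the bits of j. *)
Require Import Defs.
From HB Require Import structures.
From mathcomp Require Import all_boot all_order all_algebra.
From mathcomp Require Import complex.
From mathcomp Require Import all_classical all_reals.
From mathcomp Require Import trigo.
From mathcomp Require Import ring zify.
Import Order.TTheory GRing.Theory Num.Theory.
Local Open Scope ring_scope.
Set Implicit Arguments. Unset Strict Implicit. Unset Printing Implicit Defensive.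

(** * Nonnegative trigonometric polynomials *)

Section UnitCircle.
Variable C : numClosedFieldType.
Implicit Types (x y z w u s t : C) (p q F G : {poly C}).

Lemma circle_mulC x : `|x| = 1 -> x * x^* = 1.
Proof. by move=> x1; rewrite -normCK x1 expr1n. Qed.

Lemma circle_neq0 x : `|x| = 1 -> x != 0.
Proof. by move=> x1; rewrite -normr_eq0 x1 oner_eq0. Qed.

(** The Cayley transform maps the real line injectively into the unit circle by field operations
    alone. It supplies arbitrarily many distinct points of the circle, as well as points as close to
    1 as desired. *)
Definition cayley (t : C) : C := (1 + 'i * t) / (1 - 'i * t).

Lemma cayley_den_norm t : t \is Num.real -> 1 <= `|1 - 'i * t|.
Proof.
move=> tR; rewrite -(@ler_pXn2r _ 2) ?nnegrE // expr1n -mulrN.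
by rewrite normC2_rect ?rpred1 ?rpredN // expr1n sqrrN lerDl real_exprn_even_ge0.
Qed.

Lemma cayley_den_neq0 t : t \is Num.real -> 1 - 'i * t != 0.
Proof. by move=> tR; rewrite -normr_gt0 (lt_le_trans ltr01) ?cayley_den_norm. Qed.

Lemma norm_cayley t : t \is Num.real -> `|cayley t| = 1.
Proof.
move=> tR; have d0 := cayley_den_neq0 tR.
rewrite /cayley; have -> : 1 + 'i * t = (1 - 'i * t)^*.
  by rewrite rmorphB rmorphM /= conjCi rmorph1 (CrealP tR); ring.
by rewrite normf_div norm_conjC divff // normr_eq0.
Qed.

Lemma cayleyB1 t : t \is Num.real -> cayley t - 1 = 2 * 'i * t / (1 - 'i * t).
Proof. by move=> tR; have d0 := cayley_den_neq0 tR; rewrite /cayley; field. Qed.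

Lemma cayley_inj : {in Num.real &, injective cayley}.
Proof.
move=> s t sR tR st.
have ds := cayley_den_neq0 sR; have dt := cayley_den_neq0 tR.
have : 2 * 'i * (s - t) = 0.
  transitivity ((cayley s - cayley t) * (1 - 'i * s) * (1 - 'i * t)).
    by rewrite /cayley; field; rewrite ds dt.
  by rewrite st subrr !mul0r.
move/eqP; rewrite !mulf_eq0 pnatr_eq0 /= (negPf (neq0Ci _)) /= subr_eq0.
by move/eqP.
Qed.

Lemma circle_near1 (e : C) : 0 < e ->
  exists u : C, [/\ `|u| = 1, u != 1 & `|u - 1| <= e].
Proof.
move=> e0; have tR : e / 2 \is Num.real by rewrite gtr0_real // divr_gt0.
(* The distance from [cayley t] to 1 is 2|t| / |1 - it|, hence at most 2|t|; this gives the
   parameter [e / 2]. *)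
exists (cayley (e / 2)); split; first exact: norm_cayley.
  rewrite -subr_eq0 cayleyB1 // !mulf_neq0 ?invr_eq0 ?pnatr_eq0 ?neq0Ci //.
    by rewrite gt_eqF.
  exact: cayley_den_neq0.
have d0 := cayley_den_neq0 tR; rewrite cayleyB1 //.
have -> : 2 * 'i * (e / 2) / (1 - 'i * (e / 2)) = 'i * e / (1 - 'i * (e / 2)).
  by congr (_ / _); field.
rewrite normf_div normrM normCi mul1r (gtr0_norm e0).
rewrite ler_pdivrMr ?normr_gt0 //.
by rewrite ler_peMr ?cayley_den_norm // ltW.
Qed.

(** The Cayley images of 0, ..., [size p] - 1 would be [size p] distinct roots, more than a nonzero
    [p] can have. *)
Lemma poly_circle0 p : (forall x, `|x| = 1 -> p.[x] = 0) -> p = 0.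
Proof.
move=> p0; apply/eqP; apply: contraT => pn0.
pose rs := [seq cayley i%:R | i <- iota 0 (size p)].
have := @max_poly_roots _ p rs pn0; rewrite size_map size_iota ltnn => -> //.
  apply/allP => x /mapP[i _ ->]; apply/rootP/p0/norm_cayley.
  by rewrite ger0_real ?ler0n.
rewrite map_inj_in_uniq ?iota_uniq // => i j _ _ /cayley_inj.
by move=> /(_ _ _)/mulrIn -> //; rewrite ?oner_eq0 // ger0_real ?ler0n.
Qed.

Lemma poly_circle_inj p q : (forall x, `|x| = 1 -> p.[x] = q.[x]) -> p = q.
Proof.
move=> pq; apply/eqP; rewrite -subr_eq0; apply/eqP/poly_circle0 => x x1.
by rewrite hornerD hornerN pq // subrr.
Qed.

Lemma poly_circle_bound p :
  exists2 B : C, 0 <= B & forall x, `|x| = 1 -> `|p.[x]| <= B.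
Proof.
exists (\sum_(i < size p) `|p`_i|); first by apply: sumr_ge0.
move=> x x1; rewrite horner_coef (le_trans (ler_norm_sum _ _ _)) //.
by apply: ler_sum => i _; rewrite normrM normrX x1 expr1n mulr1.
Qed.

(** * Limit arguments on the circle *)

Lemma norm_small_eq0 (z : C) : (forall e : C, 0 < e -> `|z| <= e) -> z = 0.
Proof.
move=> ze; apply/eqP; apply: contraT; rewrite -normr_gt0 => z0.
have := ze _ (divr_gt0 z0 (ltr0n _ 2)).
by rewrite ler_pdivlMr ?ltr0n // ger_pMr // lern1.
Qed.

(* On the circle x^* = 1/x, so x^* ^+ d * G.[x] is the Laurent polynomial x^-d G(x). *)
Lemma circle_lipschitz d G w : `|w| = 1 ->
  exists2 B : C, 0 <= B & forall u, `|u| = 1 ->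
    `|(w * u)^* ^+ d * G.[w * u] - w^* ^+ d * G.[w]| <= B * `|u - 1|.
Proof.
(* [K] vanishes at 1, so X - 1 divides it, and a bound for the cofactor [K1] over the circle serves
   as Lipschitz constant. *)
move=> w1; pose K := G \Po (w *: 'X) - G.[w] *: 'X^d.
have KE u : K.[u] = G.[w * u] - G.[w] * u ^+ d.
  by rewrite /K !hornerE horner_comp !hornerE.
have /factor_theorem[K1 KK1] : root K 1.
  by apply/rootP; rewrite KE mulr1 expr1n mulr1 subrr.
have [B B0 BP] := poly_circle_bound K1.
exists B => // u u1.
have -> : (w * u)^* ^+ d * G.[w * u] - w^* ^+ d * G.[w] =
    w^* ^+ d * (u^* ^+ d * K.[u]).
  rewrite KE mulrBr -[u^* ^+ d * (_ * _)]mulrCA -exprMn [u^* * u]mulrC.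
  by rewrite circle_mulC // expr1n rmorphM exprMn; ring.
rewrite !normrM !normrX !norm_conjC u1 w1 !expr1n !mul1r KK1 hornerM normrM.
by rewrite hornerXsubC ler_wpM2r ?BP.
Qed.

(** Dividing a nonnegative function by |x - w|^2 leaves the sign unknown at [w] only; the Lipschitz
    estimate recovers it there. As a nonnegative r equals its norm, z differs from |z| by at most
    twice the distance from z to r. *)
Lemma circle_ge0_closed d G w : `|w| = 1 ->
  (forall x, `|x| = 1 -> x != w -> 0 <= x^* ^+ d * G.[x]) ->
  0 <= w^* ^+ d * G.[w].
Proof.
move=> w1 G0; have [B B0 BP] := circle_lipschitz d G w1.
set z := w^* ^+ d * G.[w].
suff /subr0_eq -> : z - `|z| = 0 by [].
apply: norm_small_eq0 => e e0.
have B1 : 0 < 2 * (B + 1) by rewrite mulr_gt0 ?ltr0n // ltr_wpDl.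
have [u [u1 un1 ue]] := circle_near1 (divr_gt0 e0 B1).
pose r := (w * u)^* ^+ d * G.[w * u].
have r0 : 0 <= r.
  apply: G0; first by rewrite normrM w1 u1 mulr1.
  by rewrite -subr_eq0 -{2}[w]mulr1 -mulrBr mulf_neq0 ?(circle_neq0 w1) ?subr_eq0.
have rz : `|r - z| <= B * `|u - 1| := BP u u1.
have h1 : `|z - `|z| | <= `|r - z| + `|r - z|.
  have -> : z - `|z| = (z - r) + (`|r| - `|z|) by rewrite (ger0_norm r0); ring.
  by rewrite (le_trans (ler_normD _ _)) // distrC lerD // ler_dist_dist.
apply: (le_trans h1).
have h2 : B * `|u - 1| <= (B + 1) * (e / (2 * (B + 1))).
  by rewrite ler_pM // lerDl.
have -> : e = (B + 1) * (e / (2 * (B + 1))) + (B + 1) * (e / (2 * (B + 1))).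
  by field; rewrite gt_eqF // ltr_wpDl.
by rewrite lerD // (le_trans rz).
Qed.

(* A zero of a nonnegative function is a double zero: adding the values at two
   points placed symmetrically about w cancels the first-order term. *)
Lemma circle_double_root d G w : `|w| = 1 ->
  (forall x, `|x| = 1 -> 0 <= x^* ^+ d * ((x - w) * G.[x])) -> G.[w] = 0.
Proof.
move=> w1 G0; have [B B0 BP] := circle_lipschitz d G w1.
pose k u := (w * u)^* ^+ d * G.[w * u].
suff /eqP : k 1 = 0.
  rewrite /k mulr1 mulf_eq0 expf_eq0 conjC_eq0 (negPf (circle_neq0 w1)) andbF.
  by move=> /eqP.
have kP u : `|u| = 1 -> 0 <= w * (u - 1) * k u.
  move=> u1; have := G0 (w * u); rewrite normrM w1 u1 mulr1 => /(_ erefl).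
  by congr (_ <= _); rewrite /k; ring.
have kB u : `|u| = 1 -> `|k u - k 1| <= B * `|u - 1|.
  by move=> u1; rewrite /k mulr1 BP.
have key u : `|u| = 1 -> u != 1 -> `|k 1| <= (`|k 1| + 3 * B) * `|u - 1|.
  move=> u1 un1; have cu1 : `|u^*| = 1 by rewrite norm_conjC.
  have e0 : 0 < `|u - 1| by rewrite normr_gt0 subr_eq0.
  have ce : `|u^* - 1| = `|u - 1| by rewrite -[LHS]norm_conjC rmorphB /= conjCK rmorph1.
  have a0 := kP u u1; have b0 := kP _ cu1.
  (* Both summands are nonnegative, and their parts in [k 1] add up to -w |u - 1|^2 [k 1], so the
     sum is of second order in |u - 1|. Each summand is at most the sum; dividing by |u - 1| then
     makes [k u] of first order. *)
  have ab : `|w * (u - 1) * k u + w * (u^* - 1) * k u^*| <=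
      `|u - 1| ^+ 2 * (`|k 1| + 2 * B).
    have -> : w * (u - 1) * k u + w * (u^* - 1) * k u^* =
        - w * ((u - 1) * (u - 1)^*) * k 1 +
        (w * (u - 1) * (k u - k 1) + w * (u^* - 1) * (k u^* - k 1)).
      have uu := circle_mulC u1.
      rewrite rmorphB rmorph1.
      have -> : (u - 1) * (u^* - 1) = 2 - u - u^*.
        by rewrite mulrBr mulrBl uu; ring.
      by ring.
    have -> : `|u - 1| ^+ 2 * (`|k 1| + 2 * B) =
        `|u - 1| ^+ 2 * `|k 1| +
        (`|u - 1| * (B * `|u - 1|) + `|u - 1| * (B * `|u - 1|)) by ring.
    rewrite (le_trans (ler_normD _ _)) // lerD //.
      by rewrite !normrM normrN w1 mul1r norm_conjC expr2.
    rewrite (le_trans (ler_normD _ _)) // lerD //.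
      by rewrite !normrM w1 mul1r ler_wpM2l // kB.
    by rewrite !normrM w1 mul1r ce ler_wpM2l // -ce kB.
  have ka : `|k u| <= `|u - 1| * (`|k 1| + 2 * B).
    rewrite -(ler_pM2l e0) mulrA -expr2 (le_trans _ ab) //.
    rewrite [X in _ <= X]ger0_norm ?addr_ge0 //.
    rewrite -[leLHS]mul1r -[X in X * _]w1 mulrA -!normrM ger0_norm //.
    by rewrite lerDl.
  have -> : (`|k 1| + 3 * B) * `|u - 1| =
     `|u - 1| * (`|k 1| + 2 * B) + B * `|u - 1| by ring.
  rewrite -{1}[k 1](subKr (k u)) (le_trans (ler_normB _ _)) // lerD // kB //.
apply: norm_small_eq0 => e e0.
have M0 : 0 < `|k 1| + 3 * B + 1.
  by rewrite ltr_wpDl // addr_ge0 // mulr_ge0.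
have [u [u1 un1 ue]] := circle_near1 (divr_gt0 e0 M0).
apply: (le_trans (key u u1 un1)).
have -> : e = (`|k 1| + 3 * B + 1) * (e / (`|k 1| + 3 * B + 1)).
  by field; rewrite gt_eqF.
by rewrite ler_pM ?lerDl // addr_ge0 // mulr_ge0.
Qed.

(** * Conjugate reciprocals and spectral factorisation *)

(** The conjugate reciprocal of [p]. On the circle it is x^m times the conjugate of p(x), so
    relations between values and their conjugates become polynomial identities. *)
Definition conj_rev (m : nat) p : {poly C} := \poly_(i < m.+1) (p`_(m - i))^*.

Lemma horner_conj_rev m p x : (size p <= m.+1)%N -> x != 0 ->
  (conj_rev m p).[x] = x ^+ m * (p.[(x^*)^-1])^*.
Proof.
move=> sp x0; rewrite horner_poly (horner_coef_wide _ sp) rmorph_sum mulr_sumr.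
rewrite (reindex_inj rev_ord_inj) /=; apply: eq_bigr => i _.
have im : (i <= m)%N by rewrite -ltnS.
rewrite subSS subKn // rmorphM rmorphXn fmorphV /= conjCK mulrCA exprVn.
by rewrite -[in X in _ = _ * (X * _)](subnK im) exprD mulfK // expf_neq0.
Qed.

Lemma horner_conj_rev_circle m p x : (size p <= m.+1)%N -> `|x| = 1 ->
  (conj_rev m p).[x] = x ^+ m * (p.[x])^*.
Proof.
move=> sp x1; rewrite horner_conj_rev ?circle_neq0 //.
suff -> : (x^*)^-1 = x by [].
apply: (mulIf (_ : x^* != 0)); first by rewrite conjC_eq0 circle_neq0.
by rewrite mulVf ?conjC_eq0 ?circle_neq0 // circle_mulC.
Qed.

(** A nonnegative value is its own conjugate, so both sides agree on the circle. This gives the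
    coefficient symmetry of [F] and the symmetry of its nonzero roots under w -> 1/conj(w). *)
Lemma conj_rev_self d F : (size F <= (2 * d).+1)%N ->
  (forall x, `|x| = 1 -> 0 <= x^* ^+ d * F.[x]) -> conj_rev (2 * d) F = F.
Proof.
move=> sF F0; apply: poly_circle_inj => x x1.
rewrite horner_conj_rev_circle // mul2n -addnn exprD -mulrA.
have : (x^* ^+ d * F.[x])^* = x^* ^+ d * F.[x] by apply/CrealP/ger0_real/F0.
rewrite rmorphM rmorphXn /= conjCK => ->.
by rewrite mulrA -exprMn circle_mulC // expr1n mul1r.
Qed.

(* Roots are peeled off in pairs w, 1/w^*, since on the circle
   (x - w) (x - 1/w^* ) / x is a constant multiple of |x - w|^2. *)
Theorem fejer_riesz d F : (size F <= (2 * d).+1)%N ->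
  (forall x, `|x| = 1 -> 0 <= x^* ^+ d * F.[x]) ->
  exists2 q : {poly C}, (size q <= d.+1)%N &
    forall x, `|x| = 1 -> `|q.[x]| ^+ 2 = x^* ^+ d * F.[x].
Proof.
elim: d F => [|d IHd] F sF F0.
  move: sF F0; rewrite muln0 => /size1_polyC -> F0.
  have a0 : 0 <= F`_0.
    by have := F0 1 (normr1 _); rewrite expr0 mul1r hornerC.
  exists (sqrtC F`_0)%:P; first by rewrite size_polyC leq_b1.
  move=> x _; rewrite !hornerC expr0 mul1r ger0_norm ?sqrtC_ge0 //.
  by rewrite sqrtCK.
have selfF := conj_rev_self sF F0.
have Ftop : F`_(2 * d.+1) = (F`_0)^*.
  by rewrite -{1}selfF coef_poly ltnSn subnn.
(* If the constant coefficient vanishes, so does the coefficient at the other end. Then F = X G with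
   the size bound lowered by two, and the factor x is absorbed in passing from d + 1 to d. *)
have [F00|F00] := eqVneq F`_0 0.
  have /factor_theorem[G FG] : root F 0 by apply/rootP; rewrite horner_coef0.
  rewrite subr0 in FG.
  have sG : (size G <= (2 * d).+1)%N.
    apply/leq_sizeP => j jd; have := coefMX G j.+1; rewrite -FG /= => <-.
    move: jd; rewrite leq_eqVlt => /predU1P[<-|jd].
      by rewrite -[(2 * d).+2]/(2 + 2 * d)%N -mulnS Ftop F00 conjC0.
    by apply/(leq_sizeP _ _ sF); rewrite mulnS.
  have FGx x : `|x| = 1 -> x^* ^+ d.+1 * F.[x] = x^* ^+ d * G.[x].
    move=> x1; rewrite FG hornerMX exprSr -mulrA [x^* * _]mulrCA [x^* * x]mulrC.
    by rewrite circle_mulC // mulr1.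
  have [|q sq qP] := IHd G sG; first by move=> x x1; rewrite -FGx ?F0.
  exists q; first exact: leqW.
  by move=> x x1; rewrite qP // FGx.
have sF' : size F = (2 * d.+1).+1.
  apply/eqP; rewrite eqn_leq sF ltnNge; apply: contra F00 => /leq_sizeP/(_ _ (leqnn _)).
  by rewrite Ftop => /eqP; rewrite conjC_eq0.
have /closed_rootP[w Fw] : size F != 1%N by rewrite sF'.
have w0 : w != 0.
  by apply: contraNneq F00 => w0; move: Fw; rewrite w0 -horner_coef0.
have cw0 : w^* != 0 by rewrite conjC_eq0.
pose w' := (w^*)^-1.
have /factor_theorem[G FG] := Fw.
(* If |w| = 1 then [w'] is [w], and nonnegativity forces a double root. Otherwise [w'] differs from
   [w], and being a root of [F] by symmetry it is a root of the cofactor. *)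
have /factor_theorem[G2 GG2] : root G w'.
  have [w1|w1] := eqVneq `|w| 1.
    have -> : w' = w.
      by apply: (mulIf cw0); rewrite /w' mulVf // circle_mulC.
    apply/rootP/(@circle_double_root d.+1 _ _ w1) => x /F0.
    by rewrite FG hornerM hornerXsubC [G.[x] * _]mulrC.
  have : root F w'.
    rewrite /root -selfF horner_conj_rev ?invr_eq0 // /w' fmorphV /= conjCK invrK.
    by rewrite (rootP Fw) conjC0 mulr0.
  rewrite FG rootM root_XsubC orbC => /orP[/eqP ww|//].
  have : `|w| ^+ 2 = 1 by rewrite normCK -{1}ww /w' mulVf.
  by move/eqP; rewrite sqrp_eq1 // (negPf w1).
(* On the circle x - w' = -w' x conj(x - w), so moving the constant -w' into the quotient leaves
   exactly |x - w|^2 in front. *)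
pose G3 := - (w^*)^-1 *: G2.
have FG3 x : `|x| = 1 ->
    x^* ^+ d.+1 * F.[x] = `|x - w| ^+ 2 * (x^* ^+ d * G3.[x]).
  move=> x1; rewrite FG GG2 /G3 !hornerM !hornerXsubC hornerZ normCK rmorphB.
  have -> : x^* ^+ d.+1 * (G2.[x] * (x - w') * (x - w)) =
     (x * x^* - x^* * w') * (x - w) * (x^* ^+ d * G2.[x]) by rewrite exprS; ring.
  by rewrite circle_mulC // /w'; field.
have G30 x : `|x| = 1 -> x != w -> 0 <= x^* ^+ d * G3.[x].
  move=> x1 xw; have := F0 x x1; rewrite FG3 // pmulr_rge0 //.
  by rewrite exprn_gt0 // normr_gt0 subr_eq0.
have G30' x : `|x| = 1 -> 0 <= x^* ^+ d * G3.[x].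
  move=> x1; have [xw|/G30 -> //] := eqVneq x w.
  by apply: circle_ge0_closed => // y y1; rewrite xw; apply: G30.
have G2n0 : G2 != 0.
  apply: contraNneq F00 => G20.
  by rewrite FG GG2 G20 !mul0r coef0.
have sG3 : (size G3 <= (2 * d).+1)%N.
  rewrite (leq_trans (size_scale_leq _ _)) //.
  move: sF; rewrite FG GG2 !size_Mmonic ?monicXsubC ?mulf_neq0 ?polyXsubC_eq0 //.
  by rewrite !size_XsubC !addn2 /= mulnS.
have [q sq qP] := IHd G3 sG3 G30'.
exists (q * ('X - w%:P)).
  by rewrite (leq_trans (size_polyMleq _ _)) // size_XsubC addn2.
by move=> x x1; rewrite FG3 // hornerM hornerXsubC normrM exprMn qP // mulrC.
Qed.
End UnitCircle.

(** * Generalized quantum signal processing *)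

Section SignalProcessing.
Variable C : numClosedFieldType.
Implicit Types (a b r s x : C) (p q : {poly C}).

Lemma normalize_pair a b : (a != 0) || (b != 0) ->
  exists v : C, [/\ v != 0, v^* = v & (a / v) * (a / v)^* + (b / v) * (b / v)^* = 1].
Proof.
move=> ab0; pose S := a * a^* + b * b^*.
have S0 : 0 < S.
  rewrite /S -!normCK; case/orP: ab0 => h.
    by rewrite ltr_pwDl ?exprn_gt0 ?normr_gt0 // exprn_ge0.
  by rewrite ltr_wpDl ?exprn_gt0 ?normr_gt0 // exprn_ge0.
have v0 : sqrtC S != 0 by rewrite sqrtC_eq0 gt_eqF.
have vR : (sqrtC S)^* = sqrtC S by apply/CrealP; rewrite ger0_real ?sqrtC_ge0 ?ltW.
exists (sqrtC S); split => //.
rewrite !rmorphM !fmorphV /= !vR.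
transitivity (S / sqrtC S ^+ 2); first by rewrite /S; field.
by rewrite sqrtCK divff ?gt_eqF.
Qed.

(** Take (r, s) to be the normalised (a', b'); the first equation is then orthogonality and the
    second is trivial. If (a', b') = 0, only the first equation matters, and (conj(b), -conj(a))
    normalised solves it; if both pairs vanish, any unit vector does. *)
Lemma orthogonal_pairs_rotation a b a' b' : a * a'^* + b * b'^* = 0 ->
  exists r s : C, [/\ r * r^* + s * s^* = 1, r^* * a + s^* * b = 0
    & - s * a' + r * b' = 0].
Proof.
move=> orth; have [h|] := boolP ((a' != 0) || (b' != 0)).
  have [v [v0 vR v1]] := normalize_pair h.
  exists (a' / v), (b' / v); split => //; last by field.
  rewrite !rmorphM !fmorphV /= !vR; transitivity ((a * a'^* + b * b'^*) / v).
    by field.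
  by rewrite orth mul0r.
rewrite negb_or !negbK => /andP[/eqP -> /eqP ->].
have [h|] := boolP ((b^* != 0) || (- a^* != 0)).
  have [v [v0 vR v1]] := normalize_pair h.
  exists (b^* / v), (- a^* / v); split => //; last by ring.
  by rewrite !rmorphM rmorphN fmorphV /= !conjCK vR; field.
rewrite negb_or !negbK oppr_eq0 !conjC_eq0 => /andP[/eqP -> /eqP ->].
by exists 1, 0; rewrite rmorph1 rmorph0; split; ring.
Qed.

Lemma rotation_norm r s a b : r * r^* + s * s^* = 1 ->
  `|r^* * a + s^* * b| ^+ 2 + `|- s * a + r * b| ^+ 2 = `|a| ^+ 2 + `|b| ^+ 2.
Proof.
move=> rs; rewrite !normCK !rmorphD !rmorphM /= !rmorphN /= !conjCK.
transitivity ((r * r^* + s * s^*) * (a * a^* + b * b^*)); first by ring.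
by rewrite rs mul1r.
Qed.

Definition circle_pair p q :=
  forall x, `|x| = 1 -> `|p.[x]| ^+ 2 + `|q.[x]| ^+ 2 = 1.

(* The coefficient of x^-d in |p|^2 + |q|^2 = 1. *)
Lemma circle_pair_coef d p q : (size p <= d.+2)%N -> (size q <= d.+2)%N ->
  circle_pair p q -> p`_0 * (p`_d.+1)^* + q`_0 * (q`_d.+1)^* = 0.
Proof.
move=> sp sq pq.
have E : p * conj_rev d.+1 p + q * conj_rev d.+1 q = 'X^(d.+1).
  apply: poly_circle_inj => x x1; rewrite !hornerE !horner_conj_rev_circle //.
  by rewrite -[RHS]mulr1 -(pq x x1) !normCK; ring.
have := congr1 (fun f : {poly C} => f`_0) E.
by rewrite coefD !coef0M coefXn /= !coef_poly /= subn0.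
Qed.

(** The inverse rotation kills the constant coefficient of the first component, which becomes X p',
    and the top coefficient of the second, which becomes q'. Being unitary, it keeps the sum of
    squares, and |x| = 1 lets the factor X be dropped. *)
Lemma circle_pair_peel d p q : (size p <= d.+2)%N -> (size q <= d.+2)%N ->
  circle_pair p q -> exists r s (p' q' : {poly C}),
  [/\ r * r^* + s * s^* = 1, (size p' <= d.+1)%N, (size q' <= d.+1)%N,
      circle_pair p' q' &
      p = r *: ('X * p') - s^* *: q' /\ q = s *: ('X * p') + r^* *: q'].
Proof.
move=> sp sq pq.
have [r [s [rs rs0 rsd]]] := orthogonal_pairs_rotation (circle_pair_coef sp sq pq).
pose q' := - s *: p + r *: q.
have /factor_theorem[p' pp'] : root (r^* *: p + s^* *: q) 0.
  by apply/rootP; rewrite !hornerE !horner_coef0.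
rewrite subr0 mulrC in pp'.
have sq' : (size q' <= d.+1)%N.
  apply/leq_sizeP => j; rewrite leq_eqVlt => /predU1P[<-|jd].
    by rewrite coefD !coefZ.
  by rewrite coefD !coefZ (leq_sizeP _ _ sp) // (leq_sizeP _ _ sq) // !mulr0 addr0.
have sp' : (size p' <= d.+1)%N.
  apply/leq_sizeP => j jd; have := coefXM p' j.+1; rewrite -pp' /= => <-.
  by rewrite coefD !coefZ (leq_sizeP _ _ sp) // (leq_sizeP _ _ sq) // !mulr0 addr0.
have rsP : (r * r^*)%:P + (s * s^*)%:P = 1 :> {poly C} by rewrite -polyCD rs.
exists r, s, p', q'; split => //.
  move=> x x1; rewrite -(pq x x1) -(rotation_norm p.[x] q.[x] rs).
  have -> : r^* * p.[x] + s^* * q.[x] = x * p'.[x].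
    by have := congr1 (fun f => f.[x]) pp'; rewrite !hornerE.
  by rewrite normrM x1 mul1r /q' !hornerE.
(* The rotation is undone by writing p and q as themselves times r conj(r) + s conj(s) = 1. *)
rewrite -pp' /q' -!mul_polyC; rewrite !polyCM in rsP.
split; [rewrite -{1}[p]mul1r|rewrite -{1}[q]mul1r]; rewrite -rsP polyCN; ring.
Qed.

(** On the circle [F] is x^d (1 - |p|^2), so [fejer_riesz] factors the defect 1 - |p|^2 as |q|^2. *)
Lemma circle_pair_completion d p : (size p <= d.+1)%N ->
  (forall x, `|x| = 1 -> `|p.[x]| ^+ 2 <= 1) ->
  exists2 q : {poly C}, (size q <= d.+1)%N & circle_pair p q.
Proof.
move=> sp p1; pose F := 'X^d - p * conj_rev d p.
have FE x : `|x| = 1 -> x^* ^+ d * F.[x] = 1 - `|p.[x]| ^+ 2.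
  move=> x1; rewrite !hornerE horner_conj_rev_circle // normCK.
  transitivity (x^* ^+ d * x ^+ d * (1 - p.[x] * (p.[x])^*)); first by ring.
  by rewrite -exprMn [x^* * x]mulrC (circle_mulC x1) expr1n mul1r.
have sF : (size F <= (2 * d).+1)%N.
  rewrite (leq_trans (size_polyD _ _)) // geq_max size_polyN size_polyXn.
  rewrite ltnS leq_pmull //= (leq_trans (size_polyMleq _ _)) //.
  rewrite -subn1 leq_subLR add1n.
  have := leq_add sp (size_poly d.+1 (fun i => (p`_(d - i))^*)).
  by rewrite addSn addnS mul2n addnn.
have [|q sq qP] := fejer_riesz sF.
  by move=> x x1; rewrite FE // subr_ge0 p1.
by exists q => // x x1; rewrite qP // FE // addrC subrK.
Qed.
End SignalProcessing.

Local Open Scope complex_scope.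

(** * Bits of register indices *)

Section Bits.
Local Open Scope nat_scope.

Lemma sum_bits n i : i < 2 ^ n -> \sum_(k < n) 2 ^ k * bit k i = i.
Proof.
elim: n i => [|n IHn] i; first by rewrite big_ord0 expn0; case: i.
rewrite expnS => i2; rewrite big_ord_recl /= expn0 mul1n.
have i2' : i./2 < 2 ^ n by rewrite -divn2 ltn_divLR // mulnC.
transitivity (odd i + 2 * \sum_(k < n) 2 ^ k * bit k i./2).
  rewrite big_distrr /=; congr (_ + _); first by rewrite /bit expn0 divn1.
  apply: eq_bigr => k _; rewrite /bump /= add1n expnS -mulnA; congr (_ * (_ * _)).
  by rewrite /bit expnS divnMA divn2.
by rewrite IHn // mul2n odd_double_half.
Qed.

Lemma agree_off_nil n i j : i < 2 ^ n -> j < 2 ^ n ->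
  agree_off n [::] i j = (i == j).
Proof.
move=> i2 j2; apply/forallP/eqP => [ij|-> k]; last by rewrite eqxx implybT.
rewrite -(sum_bits i2) -(sum_bits j2); apply: eq_bigr => k _.
by rewrite (eqP (implyP (ij k) _)).
Qed.

Lemma agree_offC n ks i j : agree_off n ks i j = agree_off n ks j i.
Proof. by apply: eq_forallb => k; rewrite eq_sym. Qed.

Lemma agree_offS n ks i j : agree_off n.+1 ks i j =
  agree_off n ks i j && ((n \notin ks) ==> (bit n i == bit n j)).
Proof.
apply/forallP/andP => [ij|[/forallP ij nij] b].
  split; last exact: (ij ord_max).
  by apply/forallP => b; exact: (ij (widen_ord (leqnSn n) b)).
have [bn|nb] := ltnP b n; first exact: (ij (Ordinal bn)).
by have -> : (b : nat) = n by apply/eqP; rewrite eqn_leq nb -ltnS ltn_ord.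
Qed.

Lemma agree_off_out n ks i j : agree_off n (n :: ks) i j = agree_off n ks i j.
Proof. by apply: eq_forallb => k; rewrite inE ltn_eqF. Qed.

Lemma agree_off_cons n k ks i j : k < n ->
  agree_off n ks i j = agree_off n (k :: ks) i j && ((k \notin ks) ==> (bit k i == bit k j)).
Proof.
move=> kn; apply/forallP/andP => [ij|[/forallP ij kij] b].
  split; last exact: (ij (Ordinal kn)).
  by apply/forallP => b; apply/implyP; rewrite inE negb_or => /andP[_]; apply/implyP.
have [bk|bk] := eqVneq (b : nat) k; first by rewrite bk.
by have := ij b; rewrite inE negb_or bk.
Qed.

Lemma pow2_double n : 2 ^ n + 2 ^ n = 2 ^ n.+1.
Proof. by rewrite addnn -mul2n expnS. Qed.

(** [lo] and [hi] prefix the ancilla bit 0 or 1 to an index. Going through [lshift] and [rshift]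
    makes them match the two halves of [block_mx]. *)
Definition lo n (i : 'I_(2 ^ n)) : 'I_(2 ^ n.+1) :=
  cast_ord (pow2_double n) (lshift _ i).
Definition hi n (i : 'I_(2 ^ n)) : 'I_(2 ^ n.+1) :=
  cast_ord (pow2_double n) (rshift _ i).

Lemma bit_lo_top n (i : 'I_(2 ^ n)) : bit n (lo i) = 0.
Proof. by rewrite /bit /= divn_small. Qed.

Lemma bit_hi_top n (i : 'I_(2 ^ n)) : bit n (hi i) = 1.
Proof. by rewrite /bit /= divnDl // divnn expn_gt0 /= divn_small. Qed.

Lemma bit_hi n (i : 'I_(2 ^ n)) k : k < n -> bit k (hi i) = bit k i.
Proof.
move=> kn; rewrite /bit /= divnDl ?dvdn_exp2l ?(ltnW kn) // oddD.
by rewrite -expnB ?(ltnW kn) // oddX subn_eq0 leqNgt kn.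
Qed.

Lemma agree_off_lo n ks (i j : 'I_(2 ^ n)) :
  agree_off n.+1 ks (lo i) (lo j) = agree_off n ks i j.
Proof. by rewrite agree_offS !bit_lo_top eqxx implybT andbT. Qed.

Lemma agree_off_hi n ks (i j : 'I_(2 ^ n)) :
  agree_off n.+1 ks (hi i) (hi j) = agree_off n ks i j.
Proof.
rewrite agree_offS !bit_hi_top eqxx implybT andbT.
by apply: eq_forallb => k; rewrite !bit_hi.
Qed.

Lemma agree_off_lohi n ks (i j : 'I_(2 ^ n)) :
  agree_off n.+1 ks (lo i) (hi j) = agree_off n ks i j && (n \in ks).
Proof.
rewrite agree_offS bit_lo_top bit_hi_top implybF negbK; congr (_ && _).
by apply: eq_forallb => k; rewrite !bit_hi.
Qed.

Lemma agree_off_hilo n ks (i j : 'I_(2 ^ n)) :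
  agree_off n.+1 ks (hi i) (lo j) = agree_off n ks i j && (n \in ks).
Proof. by rewrite agree_offC agree_off_lohi agree_offC. Qed.

Variant half_spec n : 'I_(2 ^ n.+1) -> Type :=
  | HalfLo i : half_spec (lo i)
  | HalfHi i : half_spec (hi i).

Lemma halfP n (x : 'I_(2 ^ n.+1)) : half_spec x.
Proof.
rewrite -(cast_ordKV (pow2_double n) x).
case: (split_ordP (cast_ord (esym (pow2_double n)) x)) => i ->.
  exact: HalfLo.
exact: HalfHi.
Qed.

Lemma lo_eq n (i j : 'I_(2 ^ n)) : (lo i == lo j) = (i == j).
Proof. by []. Qed.

Lemma hi_eq n (i j : 'I_(2 ^ n)) : (hi i == hi j) = (i == j).
Proof. by rewrite -!val_eqE /= eqn_add2l. Qed.

Lemma lohi_eq n (i j : 'I_(2 ^ n)) : (lo i == hi j) = false.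
Proof. by rewrite -!val_eqE /= ltn_eqF // ltn_addr. Qed.

Lemma hilo_eq n (i j : 'I_(2 ^ n)) : (hi i == lo j) = false.
Proof. by rewrite eq_sym lohi_eq. Qed.

Lemma widen_lo n (i : 'I_(2 ^ n)) : widen_ord (leq_pow2S n) i = lo i.
Proof. exact: val_inj. Qed.
End Bits.

(** * Circuits with one ancilla *)

Section Circuits.
Variable R : realType.
Local Notation C := R[i].

Section Blocks.
Variable n : nat.
Implicit Types A B D E : 'M[C]_(2 ^ n).

(* The ancilla is the most significant qubit, so these are its four blocks. *)
Definition blk A B D E : 'M[C]_(2 ^ n.+1) :=
  castmx (pow2_double n, pow2_double n) (block_mx A B D E).

Lemma blk_lolo A B D E i j : blk A B D E (lo i) (lo j) = A i j.
Proof. by rewrite castmxE !cast_ordK block_mxEul. Qed.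
Lemma blk_lohi A B D E i j : blk A B D E (lo i) (hi j) = B i j.
Proof. by rewrite castmxE !cast_ordK block_mxEur. Qed.
Lemma blk_hilo A B D E i j : blk A B D E (hi i) (lo j) = D i j.
Proof. by rewrite castmxE !cast_ordK block_mxEdl. Qed.
Lemma blk_hihi A B D E i j : blk A B D E (hi i) (hi j) = E i j.
Proof. by rewrite castmxE !cast_ordK block_mxEdr. Qed.
Definition blkE := (blk_lolo, blk_lohi, blk_hilo, blk_hihi).

Lemma mul_blk A B D E A' B' D' E' :
  blk A B D E *m blk A' B' D' E' =
  blk (A *m A' + B *m D') (A *m B' + B *m E') (D *m A' + E *m D') (D *m B' + E *m E').
Proof.
rewrite /blk -mulmx_block.
by case: (2 ^ n.+1)%N / (pow2_double n).
Qed.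

Lemma top_left_blk A B D E : top_left (blk A B D E) = A.
Proof. by apply/matrixP => i j; rewrite mxE !widen_lo blkE. Qed.

Lemma blk1 : blk 1%:M 0 0 1%:M = 1%:M.
Proof.
apply/matrixP => x y; case: (halfP x) => i; case: (halfP y) => j;
  by rewrite blkE !mxE ?lo_eq ?hi_eq ?lohi_eq ?hilo_eq.
Qed.

(** A gate that does not touch the ancilla preserves its bit and acts alike for both values. *)
Lemma gate1_extend k G : (k < n)%N ->
  gate1 n.+1 k G = blk (gate1 n k G) 0 0 (gate1 n k G).
Proof.
move=> kn; apply/matrixP => x y; case: (halfP x) => i; case: (halfP y) => j;
  rewrite blkE !mxE ?agree_off_lo ?agree_off_hi ?agree_off_lohi ?agree_off_hilo //;
  by rewrite ?bit_hi // inE gtn_eqF // andbF.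
Qed.

Lemma gate2_extend k1 k2 G : (k1 < n)%N -> (k2 < n)%N ->
  gate2 n.+1 k1 k2 G = blk (gate2 n k1 k2 G) 0 0 (gate2 n k1 k2 G).
Proof.
move=> kn1 kn2; apply/matrixP => x y; case: (halfP x) => i; case: (halfP y) => j;
  rewrite blkE !mxE ?agree_off_lo ?agree_off_hi ?agree_off_lohi ?agree_off_hilo //;
  by rewrite ?bit_hi // !inE !gtn_eqF // andbF.
Qed.

Lemma inord0 m : inord 0 = 0 :> 'I_m.+1.
Proof. by apply: val_inj; rewrite /= inordK. Qed.

Lemma inord1 m : inord 1 = 1 :> 'I_m.+2.
Proof. by apply: val_inj; rewrite /= inordK. Qed.

Lemma gate1_ancilla G :
  gate1 n.+1 n G = blk (G 0 0)%:M (G 0 1)%:M (G 1 0)%:M (G 1 1)%:M.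
Proof.
apply/matrixP => x y; case: (halfP x) => i; case: (halfP y) => j;
  rewrite blkE !mxE ?agree_off_lo ?agree_off_hi ?agree_off_lohi ?agree_off_hilo;
  rewrite agree_off_out agree_off_nil // ?bit_lo_top ?bit_hi_top ?inord0 ?inord1;
  by rewrite ?mem_head ?andbT val_eqE; case: eqP.
Qed.
End Blocks.

(** * Adjoints and circuit sizes *)

Lemma adj_mul m k l (A : 'M[C]_(m, k)) (B : 'M[C]_(k, l)) :
  adj (A *m B) = adj B *m adj A.
Proof. by rewrite /adj map_mxM trmx_mul. Qed.

Lemma adj1 m : adj 1%:M = 1%:M :> 'M[C]_m.
Proof. by rewrite /adj map_mx1 trmx1. Qed.

Lemma adjK m k (A : 'M[C]_(m, k)) : adj (adj A) = A.
Proof. by apply/matrixP => i j; rewrite !mxE conjcK. Qed.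

Lemma unitary_adj m (A : 'M[C]_m) : unitary A -> unitary (adj A).
Proof. by rewrite /unitary adjK => /mulmx1C. Qed.

Lemma adj_gate1 n k (G : 'M[C]_2) : adj (gate1 n k G) = gate1 n k (adj G).
Proof.
by apply/matrixP => i j; rewrite !mxE agree_offC; case: ifP; rewrite ?conjc0 ?mxE.
Qed.

Lemma adj_gate2 n k1 k2 (G : 'M[C]_4) :
  adj (gate2 n k1 k2 G) = gate2 n k1 k2 (adj G).
Proof.
by apply/matrixP => i j; rewrite !mxE agree_offC; case: ifP; rewrite ?conjc0 ?mxE.
Qed.

Lemma elem_gate_adj n (M : 'M[C]_(2 ^ n)) : elem_gate M -> elem_gate (adj M).
Proof.
case=> [[k [G [uG ->]]]|[k1 [k2 [G [k12 [uG ->]]]]]].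
  by left; exists k, (adj G); rewrite adj_gate1; split => //; exact: unitary_adj.
right; exists k1, k2, (adj G); rewrite adj_gate2; do 2 split => //.
exact: unitary_adj.
Qed.

Lemma elem_gate_extend n (M : 'M[C]_(2 ^ n)) : elem_gate M -> elem_gate (blk M 0 0 M).
Proof.
case=> [[k [G [uG ->]]]|[k1 [k2 [G [k12 [uG ->]]]]]].
  by left; exists (widen_ord (leqnSn n) k), G; rewrite -gate1_extend.
by right; exists (widen_ord (leqnSn n) k1), (widen_ord (leqnSn n) k2), G;
  rewrite -gate2_extend.
Qed.

Lemma foldr_mulmx_cat m (s t : seq 'M[C]_m) :
  foldr mulmx 1%:M (s ++ t) = foldr mulmx 1%:M s *m foldr mulmx 1%:M t.
Proof. by elim: s => [|A s IHs] /=; rewrite ?mul1mx // IHs mulmxA. Qed.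

Lemma circuit_size_gate n (M : 'M[C]_(2 ^ n)) : elem_gate M -> circuit_size_le M 1.
Proof.
move=> eM; exists [:: M]; split => //= [g|]; last by rewrite mulmx1.
by rewrite inE => /eqP ->.
Qed.

Lemma circuit_size_mul n (M M' : 'M[C]_(2 ^ n)) m m' :
  circuit_size_le M m -> circuit_size_le M' m' -> circuit_size_le (M *m M') (m + m').
Proof.
move=> [s [ss es ->]] [t [st et ->]]; exists (s ++ t); split.
- by rewrite size_cat leq_add.
- by move=> g; rewrite mem_cat => /orP[/es|/et].
- by rewrite foldr_mulmx_cat.
Qed.

Lemma circuit_size_leq n (M : 'M[C]_(2 ^ n)) m m' :
  (m <= m')%N -> circuit_size_le M m -> circuit_size_le M m'.
Proof.
by move=> mm' [s [ss es Ms]]; exists s; split => //; exact: leq_trans mm'.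
Qed.

Lemma circuit_size_adj n (M : 'M[C]_(2 ^ n)) m :
  circuit_size_le M m -> circuit_size_le (adj M) m.
Proof.
move=> [s [ss es ->]]; exists (rev [seq adj g | g <- s]); split.
- by rewrite size_rev size_map.
- by move=> g; rewrite mem_rev => /mapP[h /es eh ->]; exact: elem_gate_adj.
elim: s {ss es} => [|A s IHs] /=; first exact: adj1.
by rewrite adj_mul IHs rev_cons -cats1 foldr_mulmx_cat /= mulmx1.
Qed.

Lemma circuit_size_extend n (M : 'M[C]_(2 ^ n)) m :
  circuit_size_le M m -> circuit_size_le (blk M 0 0 M) m.
Proof.
move=> [s [ss es ->]]; exists [seq blk g 0 0 g | g <- s]; split.
- by rewrite size_map.
- by move=> g /mapP[h /es eh ->]; exact: elem_gate_extend.
elim: s {ss es} => [|A s IHs] /=; first exact: blk1.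
by rewrite -IHs mul_blk !mulmx0 !mul0mx !addr0 !add0r.
Qed.

(** * Controlled phases and ancilla rotations *)

Section ControlledPhase.
Variable n : nat.
Local Notation w := (omegaN R (2 ^ n)).

Lemma norm_omegaN : `|w| = 1.
Proof.
rewrite /omegaN; set t := _ / _.
apply/eqP; rewrite -sqrp_eq1 // sqr_normc eq_complex /=.
by apply/andP; split; apply/eqP; rewrite -?(cos2Dsin2 t); ring.
Qed.

Lemma UomegaE : Uomega R n = diag_mx (\row_j w ^+ j).
Proof. by rewrite diag_mx_sum_delta; apply: eq_bigr => j _; rewrite mxE. Qed.

(* The index of gate2 is 2 * ancilla + target bit, so index 1 puts the phase on
   ancilla 0, target 1: the control is on |0>. *)
Definition phase_diag (k : nat) : 'rV[C]_4 :=
  \row_j (if j == 1 then w ^+ (2 ^ k) else 1).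

Lemma unitary_phase_diag k : unitary (diag_mx (phase_diag k)).
Proof.
rewrite /unitary /adj map_diag_mx tr_diag_mx mulmx_diag -diag_const_mx.
congr diag_mx; apply/rowP => j; rewrite !mxE.
case: ifP => _; last by rewrite rmorph1 mulr1.
by rewrite -sqr_normc normrX norm_omegaN !expr1n.
Qed.

(** A nonzero entry needs agreement of the indices off k1 and k2 and, the gate being diagonal, equal
    bits at k1 and k2 too; so the indices coincide. *)
Lemma gate2_diag m (k1 k2 : 'I_m) (d : 'rV[C]_4) :
  gate2 m k1 k2 (diag_mx d) =
  diag_mx (\row_(i < 2 ^ m) d 0 (inord (2 * bit k1 i + bit k2 i))).
Proof.
apply/matrixP => i j; rewrite !mxE.
have [->|ij] := eqVneq i j.
  by rewrite /agree_off (introT forallP) ?eqxx // => b; rewrite eqxx implybT.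
case: ifP => // aij; case: eqP => //.
move/(congr1 (@nat_of_ord _)).
have bit4 a b : (2 * bit k1 a + bit k2 b < 4)%N.
  by rewrite /bit; case: odd; case: odd.
rewrite !inordK // => e.
have [e1 e2] : bit k1 i = bit k1 j /\ bit k2 i = bit k2 j.
  by move: e; rewrite /bit; do 4 case: odd.
move: ij; rewrite -val_eqE -(agree_off_nil (ltn_ord i) (ltn_ord j)).
rewrite (agree_off_cons _ _ _ (ltn_ord k2)) (agree_off_cons _ _ _ (ltn_ord k1)).
by rewrite aij e1 e2 !eqxx !implybT.
Qed.

Lemma foldr_mulmx_diag (I : Type) m (s : seq I) (f : I -> 'rV[C]_m) :
  foldr mulmx 1%:M [seq diag_mx (f k) | k <- s] =
  diag_mx (\row_j \prod_(k <- s) f k 0 j).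
Proof.
elim: s => [|k s IHs] /=.
  by rewrite -diag_const_mx; congr diag_mx; apply/rowP => j; rewrite !mxE big_nil.
by rewrite IHs mulmx_diag; congr diag_mx; apply/rowP => j; rewrite !mxE big_cons.
Qed.

(** One gate per bit: with ancilla 0 the phases multiply to omega^j through the binary expansion of
    j, and with ancilla 1 every phase is 1. *)
Lemma circuit_size_controlled_Uomega :
  circuit_size_le (blk (Uomega R n) 0 0 1%:M) n.
Proof.
exists [seq gate2 n.+1 n k (diag_mx (phase_diag k)) | k : 'I_n <- enum 'I_n]; split.
- by rewrite size_map size_enum_ord.
- move=> g /mapP[k _ ->]; right.
  exists ord_max, (widen_ord (leqnSn n) k), (diag_mx (phase_diag k)); split.
    by rewrite -val_eqE /= gtn_eqF.
  by split => //; exact: unitary_phase_diag.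
under eq_map => k do rewrite (gate2_diag (ord_max : 'I_n.+1) (widen_ord (leqnSn n) k)).
rewrite foldr_mulmx_diag UomegaE; apply/matrixP => x y.
case: (halfP x) => i; case: (halfP y) => j;
  rewrite blkE !mxE ?lo_eq ?hi_eq ?lohi_eq ?hilo_eq //.
- case: eqVneq => [->|//]; rewrite !mulr1n big_enum /=.
  rewrite -{1}(sum_bits (ltn_ord j)) -prodrXr; apply: eq_bigr => k _.
  rewrite !mxE bit_lo_top muln0 add0n exprM.
  have -> : bit k (lo j) = bit k j by [].
  rewrite -val_eqE /=; rewrite /bit; case: odd => /=; rewrite inordK ?expr1 ?expr0 //.
- case: eqVneq => [->|//]; rewrite !mulr1n big_enum /= big1 // => k _.
  by rewrite !mxE bit_hi_top -val_eqE /= inordK /bit; case: odd.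
Qed.

(** Applied to the column (X p', q'), this matrix performs the recombination of
    [circle_pair_peel]. *)
Definition rotation (r s : C) : 'M[C]_2 :=
  \matrix_(i, j) if i == 0 then if j == 0 then r else - s^* else
                 if j == 0 then s else r^*.

Lemma unitary_rotation r s : r * r^* + s * s^* = 1 -> unitary (rotation r s).
Proof.
move=> rs; apply/matrixP => i j; rewrite !mxE !big_ord_recl big_ord0 !mxE /= addr0.
case: i => [[|[|//]] hi]; case: j => [[|[|//]] hj]; rewrite /= ?rmorphN /= ?conjcK.
- by rewrite -rs; ring.
- by ring.
- by ring.
- by rewrite -rs; ring.
Qed.

Lemma circuit_size_rotation r s : r * r^* + s * s^* = 1 ->
  circuit_size_le (blk r%:M (- s^*)%:M s%:M (r^*)%:M : 'M[C]_(2 ^ n.+1)) 1.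
Proof.
move=> rs; apply: circuit_size_gate; left; exists ord_max, (rotation r s).
by split; [exact: unitary_rotation|rewrite gate1_ancilla !mxE].
Qed.

(** This is p(U_omega), given by its eigenvalues; the agreement with the power sum is established
    inside [poly_mx_conj]. *)
Definition poly_diag (p : {poly C}) : 'M[C]_(2 ^ n) :=
  diag_mx (\row_j p.[w ^+ j]).

Lemma poly_diagD p q : poly_diag (p + q) = poly_diag p + poly_diag q.
Proof. by rewrite -raddfD; congr diag_mx; apply/rowP => j; rewrite !mxE hornerD. Qed.

Lemma poly_diagZ a p : poly_diag (a *: p) = a *: poly_diag p.
Proof. by rewrite -linearZ; congr diag_mx; apply/rowP => j; rewrite !mxE hornerZ. Qed.

Lemma poly_diagXM p : poly_diag ('X * p) = Uomega R n *m poly_diag p.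
Proof.
by rewrite UomegaE mulmx_diag; congr diag_mx; apply/rowP => j; rewrite !mxE hornerM hornerX.
Qed.

Lemma poly_diagC a : poly_diag a%:P = a%:M.
Proof. by rewrite -diag_const_mx; congr diag_mx; apply/rowP => j; rewrite !mxE hornerC. Qed.

(** Only the first block column is prescribed; [B] and [D] are whatever the product yields. Each
    degree costs n controlled phases and one rotation, and the constant pair at the end costs one
    more rotation. *)
Lemma signal_processing d (p q : {poly C}) :
  (size p <= d.+1)%N -> (size q <= d.+1)%N -> circle_pair p q ->
  exists B D, circuit_size_le (blk (poly_diag p) B (poly_diag q) D) (d * n.+1 + 1).
Proof.
elim: d p q => [|d IHd] p q sp sq pq.
  rewrite (size1_polyC sp) (size1_polyC sq) in pq *.
  exists (- (q`_0)^*)%:M, ((p`_0)^*)%:M; rewrite !poly_diagC.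
  apply: circuit_size_rotation.
  by have := pq 1 (normr1 _); rewrite !hornerC !sqr_normc.
have [r [s [p' [q' [rs sp' sq' pq' [-> ->]]]]]] := circle_pair_peel sp sq pq.
have [B [D W]] := IHd p' q' sp' sq' pq'.
have := circuit_size_mul (circuit_size_rotation rs)
  (circuit_size_mul circuit_size_controlled_Uomega W).
rewrite !mul_blk !mul0mx !addr0 !add0r !mul1mx !mul_scalar_mx -poly_diagXM.
rewrite -!poly_diagZ -!poly_diagD scaleNr.
rewrite addnA add1n addnA -mulSn.
by move=> h; eexists; eexists; exact: h.
Qed.
End ControlledPhase.

(** * Conjugation by the basis change and the final gate count *)

Lemma exp_conj_mx m (Q A : 'M[C]_m) k : unitary Q ->
  (adj Q *m A *m Q) ^+ k = adj Q *m (A ^+ k) *m Q.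
Proof.
move=> uQ; elim: k => [|k IHk].
  by rewrite !expr0 mulmx1 (mulmx1C uQ).
rewrite !exprS IHk -!mulmxE !mulmxA; congr (_ *m _ *m _).
by rewrite -[_ *m Q *m adj Q]mulmxA uQ mulmx1.
Qed.

Lemma poly_mx_conj n p (Q : 'M[C]_(2 ^ n)) : unitary Q ->
  poly_mx p (adj Q *m Uomega R n *m Q) = adj Q *m poly_diag n p *m Q.
Proof.
move=> uQ.
have UX k : Uomega R n ^+ k = poly_diag n 'X^k.
  elim: k => [|k IHk]; first by rewrite !expr0 -polyC1 poly_diagC.
  by rewrite !exprS poly_diagXM -IHk.
have -> : poly_diag n p = \sum_(k < size p) p`_k *: Uomega R n ^+ k.
  rewrite -{1}[p]coefK poly_def.
  have pd0 : poly_diag n 0 = 0 by rewrite -polyC0 poly_diagC -scalemx1 scale0r.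
  rewrite (big_morph (poly_diag n) (@poly_diagD n) pd0).
  by apply: eq_bigr => k _; rewrite poly_diagZ UX.
rewrite /poly_mx; move: (Uomega R n) => V.
rewrite mulmx_sumr mulmx_suml; apply: eq_bigr => k _.
by rewrite exp_conj_mx // -scalemxAr -scalemxAl.
Qed.

(** Extended to the ancilla, [Q] and its adjoint are block diagonal, so they conjugate the top-left
    block without mixing in the others, at [m] gates each. *)
Lemma block_encoding n d m (p : {poly C}) (Q : 'M[C]_(2 ^ n)) :
  circuit_size_le Q m -> (size p <= d.+1)%N ->
  (forall x : C, `|x| = 1 -> `|p.[x]| ^+ 2 <= 1) ->
  exists U : 'M[C]_(2 ^ n.+1), circuit_size_le U (d * n.+1 + 1 + 2 * m) /\
    top_left U = adj Q *m poly_diag n p *m Q.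
Proof.
move=> cQ sp p1; have [q sq pq] := circle_pair_completion sp p1.
have [B [D W]] := signal_processing n sp sq pq.
exists (blk (adj Q) 0 0 (adj Q) *m (blk (poly_diag n p) B (poly_diag n q) D) *m
  blk Q 0 0 Q); split.
  have := circuit_size_mul (circuit_size_mul
    (circuit_size_extend (circuit_size_adj cQ)) W) (circuit_size_extend cQ).
  by apply: circuit_size_leq; rewrite mul2n -addnn addnAC addnC addnA.
by rewrite !mul_blk top_left_blk !mul0mx !mulmx0 !addr0.
Qed.
End Circuits.

Theorem theorem11 (R : realType) (K0 : nat) :
  exists K : nat,
  forall (n chi d : nat) (p : {poly R[i]}) (c : R) (lam Q : 'M[R[i]]_(2 ^ n)),
    orthonormal_basis lam ->
    unitary Q ->
    Uomega_lam lam = adj Q *m Uomega R n *m Q ->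
    circuit_size_le Q (K0 * chi)%N ->
    size p = d.+1 ->
    (forall x : R[i], `|x| = 1 -> `|p.[x]| ^+ 2 <= c%:C) ->
    exists U : 'M[R[i]]_(2 ^ n.+1),
      circuit_size_le U (K * (d * n + chi + 1))%N /\
      top_left U = (Num.sqrt c)^-1%:C *: poly_mx p (Uomega_lam lam).
Proof.
(* For n >= 1 the cost d (n + 1) + 1 + 2 K0 chi is at most 2 d n + 1 + 2 K0 chi, because n + 1 <= 2
   n; the constant covers both coefficients. *)
exists (2 * K0 + 2)%N => n chi d p c lam Q _ uQ -> cQ sp pc.
rewrite poly_mx_conj //.
have [c0|c0] := leP c 0.
  (* Then (Num.sqrt c)^-1 = 0^-1 = 0, and a bit flip of the ancilla has zero top-left block. *)
  exists (blk (0 : R[i])%:M (- 1^*)%:M 1%:M (0^*)%:M); split.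
    apply: circuit_size_leq (circuit_size_rotation _ _).
      by rewrite muln_gt0 !addn_gt0 orbT orbT.
    by rewrite rmorph0 rmorph1 mulr1 mulr0 add0r.
  rewrite top_left_blk ler0_sqrtr // invr0 scale0r.
  by rewrite -scalemx1 scale0r.
have sc0 : 0 < Num.sqrt c by rewrite sqrtr_gt0.
set a := (Num.sqrt c)^-1%:C.
have ap x : `|x| = 1 -> `|(a *: p).[x]| ^+ 2 <= 1.
  move=> x1; rewrite hornerZ normrM exprMn.
  have -> : `|a| ^+ 2 = (c^-1)%:C.
    rewrite sqr_normc conjc_real -rmorphM /= -expr2 exprVn sqr_sqrtr ?ltW //.
  rewrite (le_trans (ler_wpM2l _ (pc x x1))) ?lecR ?invr_ge0 ?(ltW c0) //.
  by rewrite -rmorphM /= mulVf ?gt_eqF.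
rewrite scalemxAl scalemxAr -poly_diagZ.
case: n lam Q uQ cQ => [|n] lam Q uQ cQ.
  (* For n = 0 the budget d * n does not pay for the rotations, but only the value p(1) matters. *)
  have sC : (size ((a *: p).[1])%:P <= 1)%N by rewrite size_polyC leq_b1.
  have [|U [cU UE]] := block_encoding cQ sC.
    by move=> x _; rewrite hornerC ap ?normr1.
  exists U; split; first by apply: circuit_size_leq cU; nia.
  rewrite UE; congr (_ *m _ *m _); congr diag_mx; apply/rowP => j; rewrite !mxE hornerC.
  by have -> : j = 0 :> nat by case: j => -[].
have sap : (size (a *: p) <= d.+1)%N by rewrite -sp size_scale_leq.
have [U [cU UE]] := block_encoding cQ sap ap.
exists U; split => //.
by apply: circuit_size_leq cU; nia.
Qed.
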